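(* Let $\mathbb X,\mathbb Y$ be finite-dimensional Hilbert spaces, $\lambda>0$, $z\in\mathbb X$, $b\in\mathbb Y$. Let $f:\mathbb X\to\mathbb R\cup\{+\infty\}$ be proper, lower semicontinuous and prox-bounded with threshold $\lambda_f>\lambda$, let $A:\mathbb X\to\mathbb Y$ be a surjective linear operator, and assume $\mathcal F:=\{x\in\operatorname{dom} f: Ax=b\}$ is nonempty. Then the following statements are equivalent: (i) (Attainable strong duality) there exist $x^*\in\mathcal F$ and $y^*\in\mathbb Y$ such that $v(P)=\lambda f(x^* )+\tfrac12\|x^*-z\|^2=-\Phi_z(y^* )=v(D)$, i.e. $x^*$ solves the primal problem (P), $y^*$ solves the dual problem (D), and there is no duality gap; (ii) (Lagrangian saddle point) there exist $x^*\in\mathcal F$ and $y^*\in\mathbb Y$ such that $x^*\in\arg\min_{x\in\mathbb X}L(x,y^* )$; (iii) (Dual inclusion) there exists $y^*\in\mathbb Y$ such that $0\in A\,\operatorname{Prox}_{\lambda f}(z+A^*y^* )-b$.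
   Context: The primal problem is (P): $v(P)=\min_{x\in\mathbb X}\{\lambda f(x)+\tfrac12\|x-z\|^2 : Ax=b\}$. The Lagrangian is $L(x,y)=\lambda f(x)+\tfrac12\|x-z\|^2+\langle y,b-Ax\rangle$ for $x\in\mathbb X$, $y\in\mathbb Y$. The function $\Phi_z$ is defined by $-\Phi_z(y)=\inf_{x\in\mathbb X}L(x,y)$; equivalently $-\Phi_z(y)=E_{\lambda f}(z+A^*y)-\tfrac12\|z+A^*y\|^2+\langle b,y\rangle+\tfrac12\|z\|^2$. The dual problem is (D): $v(D)=-\min_{y\in\mathbb Y}\Phi_z(y)$ (optimal values understood as inf/sup when not attained). For a function $h$, $E_h(t)=\inf_x\{h(x)+\tfrac12\|x-t\|^2\}$ is the Moreau envelope and $\operatorname{Prox}_h(t)=\arg\min_x\{h(x)+\tfrac12\|x-t\|^2\}$ is the (set-valued) proximal mapping. $f$ is prox-bounded if there is $\gamma>0$ with $E_{\gamma f}(x)>-\infty$ for some $x\in\mathbb X$; the supremum $\lambda_f$ of all such $\gamma$ is the threshold of prox-boundedness. For a set $S\subseteq\mathbb X$, $AS-b=\{Ax-b:x\in S\}$. $A^*$ is the adjoint of $A$. *)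

(* Defs.v *)
From HB Require Import structures.
From mathcomp Require Import all_boot all_order all_algebra.
From mathcomp Require Import all_classical all_reals all_analysis.

Set Implicit Arguments.
Unset Strict Implicit.
Unset Printing Implicit Defensive.

Import Order.TTheory GRing.Theory Num.Theory.
Import numFieldNormedType.Exports.

Local Open Scope classical_set_scope.
Local Open Scope ring_scope.

HB.mixin Record NormedModule_hasDot (R : realType) X of NormedModule R X := {
  inner : {dot X for idfun} ;
  inner_normE : forall x : X, inner x x = `|x| ^+ 2
}.

(* Completeness is automatic in finite dimension, hence not a field. *)
#[short(type="finHilbertType")]
HB.structure Definition FinHilbert (R : realType) :=
  { X of NormedModule R X & Vector R X & NormedModule_hasDot R X }.

Section Adjoint.
Context {R : realType}.

Lemma innerC (X : finHilbertType R) (x y : X) : inner x y = inner y x.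
Proof. by rewrite hermitian_subproof expr0 mul1r. Qed.

Context {X Y : finHilbertType R}.

(* The default value 0 is never used: see adjointP. *)
Definition adjoint (A : {linear X -> Y}) (y : Y) : X :=
  xget 0 [set u : X | forall x : X, inner (A x) y = inner x u].

Lemma riesz (phi : {linear X -> R^o}) :
  exists u : X, forall x, phi x = inner x u.
Proof.
pose e := vbasis {: X}.
pose g (u : X) : 'rV[R]_(\dim {: X}) := \row_i inner e`_i u.
have gl : linear g.
  by move=> a u v; apply/rowP => i; rewrite !mxE linearP.
pose gL := GRing.isLinear.Build R X _ _ g gl.
pose gl' : {linear X -> 'rV[R]_(\dim {: X})} := HB.pack g gL.
pose G := linfun gl'.
have lin1 (x : X) : x = \sum_i coord e i x *: e`_i.
  by apply: coord_vbasis; rewrite memvf.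
have expand (psi : {linear X -> R^o}) x :
    psi x = \sum_i coord e i x *: psi e`_i.
  by rewrite {1}(lin1 x) linear_sum; apply: eq_bigr => i _; rewrite linearZ.
have sumE (u x : X) : inner x u = \sum_i coord e i x * inner e`_i u.
  rewrite innerC {1}(lin1 x) linear_sum; apply: eq_bigr => i _.
  by rewrite linearZ /= innerC.
have kerG : lker G = 0%VS.
  apply/eqP; rewrite -subv0; apply/subvP => u.
  rewrite memv_ker memv0 lfunE /= => /eqP gu0.
  have uu0 : inner u u = 0.
    rewrite sumE big1 // => i _.
    by move/rowP/(_ i): gu0; rewrite !mxE => ->; rewrite mulr0.
  by move: uu0; rewrite inner_normE => /eqP; rewrite sqrf_eq0 normr_eq0.
have limG : limg G = fullv.
  apply/eqP; rewrite eqEdim subvf /=.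
  have := limg_ker_dim G fullv; rewrite kerG capv0 dimv0 add0n => ->.
  by rewrite dimvf /dim /= mul1n.
have /memv_imgP [u _ Gu] :
    (\row_i phi e`_i : 'rV[R]_(\dim {: X})) \in limg G.
  by rewrite limG memvf.
exists u => x; rewrite sumE expand; apply: eq_bigr => i _.
by move/rowP/(_ i): Gu; rewrite lfunE !mxE => ->.
Qed.

Lemma adjointP (A : {linear X -> Y}) (x : X) (y : Y) :
  inner (A x) y = inner x (adjoint A y).
Proof.
rewrite /adjoint; case: xgetP => [u _ ->//|/= no].
have phil : linear (fun x => inner (A x) y : R^o).
  by move=> a u v; rewrite linearP ![inner _ y]innerC linearP.
pose phi : {linear X -> R^o} :=
  HB.pack (fun x => inner (A x) y : R^o) (GRing.isLinear.Build R X _ _ _ phil).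
by have [u Hu] := riesz phi; case: (no u) => x'; exact: (Hu x').
Qed.

End Adjoint.

Local Open Scope ereal_scope.

Section ExtendedValued.
Context {R : realType} {X : normedModType R}.
Implicit Types (h : X -> \bar R) (t x : X).

Definition edom h : set X := [set x | h x < +oo].

Definition proper_fun h := (forall x, -oo < h x) /\ edom h !=set0.

(* For h identically +oo this is the whole space; it is only used for proper
   objectives, where the minimum value is finite. *)
Definition argmin h : set X := [set x | forall u, h x <= h u].

Definition scale_fun (c : R) h : X -> \bar R := fun x => c%:E * h x.

Definition prox_obj h t : X -> \bar R :=
  fun x => h x + (2^-1 * `|x - t| ^+ 2)%:E.

Definition moreau_env h t : \bar R := ereal_inf (range (prox_obj h t)).

Definition prox h t : set X := argmin (prox_obj h t).

Definition prox_params h : set R :=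
  [set gamma | (0 < gamma)%R /\ exists x, -oo < moreau_env (scale_fun gamma h) x].

Definition prox_bounded h := prox_params h !=set0.

Definition prox_threshold h : \bar R := ereal_sup (EFin @` prox_params h).

End ExtendedValued.

Section Duality.
Context {R : realType} {X Y : finHilbertType R}.
Variables (lambda : R) (f : X -> \bar R) (z : X) (A : {linear X -> Y}) (b : Y).

Definition feasible : set X := [set x | edom f x /\ A x = b].

Definition primal_obj (x : X) : \bar R := prox_obj (scale_fun lambda f) z x.

Definition primal_val : \bar R := ereal_inf (primal_obj @` [set x | A x = b]).

Definition lagrangian (x : X) (y : Y) : \bar R :=
  primal_obj x + (inner y (b - A x)%R)%:E.

Definition dual_obj (y : Y) : \bar R :=
  - ereal_inf (range (lagrangian ^~ y)).

Definition dual_val : \bar R := - ereal_inf (range dual_obj).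

End Duality.

(* Main.v *)
Require Import Defs.
From mathcomp Require Import all_boot all_order all_algebra.
From mathcomp Require Import all_classical all_reals all_analysis.
From mathcomp Require Import ring.
Import numFieldNormedType.Exports.
Local Open Scope classical_set_scope.
Local Open Scope ring_scope.
Local Open Scope ereal_scope.

(** The equivalence is the saddle-point characterization of Lagrangian duality,
    combined with a completion of the square.

    On the affine set [A x = b] the Lagrangian does not depend on the
    multiplier: it equals the primal objective ([lagrangian_feasible]).  Weak
    duality follows, since the infimum of [L(., y)] over the whole space lies
    below its infimum over that affine set.  Strong duality attained at
    [(xs, ys)] says that the infimum of [L(., ys)] is the primal objective at
    [xs], which is [L(xs, ys)]; hence [xs] minimizes [L(., ys)].  Conversely, if
    a feasible [xs] minimizes [L(., ys)], then [L(xs, ys)] bounds every dual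
    value from above and every primal value from below, and it is a value of
    both problems.

    For the dual inclusion, the multiplier term of the Lagrangian is absorbed
    into the quadratic term by moving the proximal centre from [z] to
    [z + A^* y].  The remainder depends only on [y] ([lagrangian_prox_obj]), so
    that minimizing [L(., y)] is the same as computing the proximal mapping at
    the moved centre ([argmin_lagrangian]).  A proximal point lies in
    the domain of [f] as soon as that domain is nonempty, so the equation
    [A x = b] is all that remains of feasibility ([prox_edom]). *)

Import Order.TTheory GRing.Theory Num.Theory.

Lemma innerBr (R : realType) (X : finHilbertType R) (u v w : X) :
  inner u (v - w)%R = (inner u v - inner u w)%R.
Proof. by rewrite linearB. Qed.

Lemma norm_sqrB (R : realType) (X : finHilbertType R) (u v : X) :
  (`|u - v| ^+ 2 = `|u| ^+ 2 - 2 * inner u v + `|v| ^+ 2)%R.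
Proof.
rewrite -!inner_normE innerBr ![inner (u - v)%R _]innerC !innerBr.
by rewrite [inner v u]innerC; ring.
Qed.

Lemma argmin_addr (R : realType) (X : normedModType R) (h : X -> \bar R)
    (c : R) :
  argmin (fun x => h x + c%:E) = argmin h.
Proof.
by apply/seteqP; split => x hx u; move: (hx u); rewrite leeD2rE.
Qed.

Lemma ereal_inf_argmin (R : realType) (X : normedModType R) (h : X -> \bar R)
    (S : set X) (x : X) :
  S x -> (forall u, S u -> h x <= h u) -> ereal_inf (h @` S) = h x.
Proof.
move=> Sx hx; apply/eqP; rewrite eq_le; apply/andP; split.
  by apply: ereal_inf_lbound; exists x.
by apply: le_ereal_inf_tmp => _ [u Su <-]; exact: hx.
Qed.

(** Comparing with one point of the domain suffices: the quadratic term is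
    finite, and a positive multiple of [+oo] is [+oo]. *)
Lemma prox_edom (R : realType) (X : normedModType R) (lambda : R)
    (f : X -> \bar R) (t x : X) :
  (0 < lambda)%R -> edom f !=set0 -> prox (scale_fun lambda f) t x -> edom f x.
Proof.
move=> l0 [x0 fx0] /(_ x0); rewrite /edom /prox_obj /scale_fun /=.
apply: contraPT; rewrite -leNgt leye_eq => /eqP ->.
rewrite gt0_muley ?lte_fin// addye// leye_eq.
move: fx0; rewrite /edom /=; case: (f x0) => [r||] // _.
by rewrite gt0_muleNy ?lte_fin.
Qed.

Section Lagrangian.
Context {R : realType} {X Y : finHilbertType R}.
Variables (lambda : R) (f : X -> \bar R) (z : X) (A : {linear X -> Y}) (b : Y).

Local Notation P := (primal_obj lambda f z).
Local Notation L := (lagrangian lambda f z A b).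

Lemma lagrangian_feasible (x : X) (y : Y) : A x = b -> L x y = P x.
Proof. by move=> Axb; rewrite /lagrangian Axb subrr linear0 adde0. Qed.

(** Completion of the square: the cross term [<x - z, A^* y>] of
    [|x - (z + A^* y)|^2 / 2] is [<A x - A z, y>], which cancels the dependence
    of the multiplier term on [x]. *)
Lemma lagrangian_prox_obj (x : X) (y : Y) :
  L x y = prox_obj (scale_fun lambda f) (z + adjoint A y)%R x
          + (inner y (b - A z) - 2^-1 * `|adjoint A y| ^+ 2)%:E.
Proof.
rewrite /lagrangian /primal_obj /prox_obj -!addeA; congr (_ + _).
rewrite -!EFinD; congr (_%:E).
have -> : (x - (z + adjoint A y) = x - z - adjoint A y)%R.
  by rewrite opprD addrA.
rewrite [(`|x - z - _| ^+ 2)%R]norm_sqrB -adjointP.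
by rewrite [inner (A _) y]innerC linearB /= !innerBr; field.
Qed.

Lemma argmin_lagrangian (y : Y) :
  argmin (L ^~ y) = prox (scale_fun lambda f) (z + adjoint A y)%R.
Proof.
rewrite /prox -[RHS](argmin_addr _ _ _
  (inner y (b - A z) - 2^-1 * `|adjoint A y| ^+ 2)%R).
by congr argmin; apply/funext => x; exact: lagrangian_prox_obj.
Qed.

Lemma strong_duality_argmin (xs : X) (ys : Y) :
  A xs = b -> P xs = - dual_obj lambda f z A b ys -> argmin (L ^~ ys) xs.
Proof.
move=> Axb Pxs u; rewrite lagrangian_feasible// Pxs oppeK.
by apply: ereal_inf_lbound; exists u.
Qed.

Lemma argmin_strong_duality (xs : X) (ys : Y) :
  A xs = b -> argmin (L ^~ ys) xs ->
  [/\ primal_val lambda f z A b = P xs,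
      P xs = - dual_obj lambda f z A b ys &
      - dual_obj lambda f z A b ys = dual_val lambda f z A b].
Proof.
move=> Axb xs_min.
have PE : P xs = - dual_obj lambda f z A b ys.
  rewrite oppeK (@ereal_inf_argmin _ _ (L ^~ ys) setT xs)//.
  by rewrite lagrangian_feasible.
split=> //.
  apply: ereal_inf_argmin => // u Aub.
  by have := xs_min u; rewrite !lagrangian_feasible.
(* Weak duality: each dual function value is at most L(xs, y) = P xs. *)
congr (- _); symmetry; apply: ereal_inf_argmin => // y _.
rewrite -leeN2 -PE -(lagrangian_feasible _ y Axb) oppeK.
by apply: ereal_inf_lbound; exists xs.
Qed.

End Lagrangian.

Theorem proposition1 (R : realType) (X Y : finHilbertType R)
    (lambda : R) (z : X) (b : Y) (f : X -> \bar R) (A : {linear X -> Y})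
    (lambda_gt0 : (0 < lambda)%R)
    (f_proper : proper_fun f)
    (f_lsc : lower_semicontinuous f)
    (f_pb : prox_bounded f)
    (f_threshold : lambda%:E < prox_threshold f)
    (A_surj : set_surj [set: X] [set: Y] A)
    (F_neq0 : feasible f A b !=set0) :
  let attainable_strong_duality :=
    exists xs : X, exists ys : Y,
      [/\ feasible f A b xs,
          primal_val lambda f z A b = primal_obj lambda f z xs,
          primal_obj lambda f z xs = - dual_obj lambda f z A b ys &
          - dual_obj lambda f z A b ys = dual_val lambda f z A b] in
  let lagrangian_saddle_point :=
    exists xs : X, exists ys : Y,
      feasible f A b xs /\
      argmin (fun x : X => lagrangian lambda f z A b x ys) xs in
  let dual_inclusion :=
    exists ys : Y,
      [set (A x - b)%R | x in prox (scale_fun lambda f) (z + adjoint A ys)%R] 0%R in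
  (attainable_strong_duality <-> lagrangian_saddle_point) /\
  (lagrangian_saddle_point <-> dual_inclusion).
Proof.
split; split.
- move=> [xs [ys [xs_feas _ PD _]]]; exists xs, ys; split=> //.
  by case: xs_feas => _ Axb; exact: strong_duality_argmin.
- move=> [xs [ys [xs_feas xs_min]]]; exists xs, ys.
  by have [] := argmin_strong_duality _ _ _ _ _ _ _ xs_feas.2 xs_min.
- move=> [xs [ys [[_ Axb] xs_min]]]; exists ys, xs; last by rewrite Axb subrr.
  by rewrite -(argmin_lagrangian _ _ _ _ b).
- move=> [ys [xs xs_prox /subr0_eq Axb]]; exists xs, ys.
  split; last by rewrite argmin_lagrangian.
  split=> //; apply: prox_edom lambda_gt0 _ xs_prox.
  by case: F_neq0 => x0 [fx0 _]; exists x0.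
Qed.
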